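(* The communication complexity $C_T$ of the CO-UCB algorithm is $O(M\Theta T)$.
   Context: Model (action-constrained cooperative multi-agent bandit). There are agents $\mathcal{A}=\{1,\dots,M\}$ and arms $\mathcal{K}=\{1,\dots,K\}$; agent $j$ can only pull arms in its local set $\mathcal{K}_j\subseteq\mathcal{K}$, and the local sets of at least two agents overlap. Arm $i$ yields i.i.d. Bernoulli rewards with mean $\mu(i)\in[0,1]$; the reward sequences of different arms are mutually independent. The time horizon is $\{1,\dots,T\}$. Agent $j$ has an inter-round gap $\omega_j\in\mathbb{N}^+$ and action rate $\theta_j=1/\omega_j$: it pulls one arm at each of its decision rounds $t=l\omega_j$, $l=1,\dots,N_j$, where $N_j=\lfloor T/\omega_j\rfloor$. Every agent can send messages to any other agent, with deterministic delays. $\Theta=\sum_{j\in\mathcal{A}}\theta_j$. Communication complexity. $C_T$ is the total number of messages sent by all agents in $[1,T]$; sending one observation from one agent to one other agent costs one message. Confidence intervals. Parameters are $\alpha>2$ and $\delta_t\in(0,1]$. $\hat n_t^j(i)$ is the number of observations of arm $i$ available to agent $j$ by time $t$ (from slots $1$ to $t-1$, both its own pulls and observations already received from other agents), $\hat\mu(i,n)$ is the average of the $n$ observations of arm $i$, and $\mathrm{CI}(i,j,t)=\sqrt{\alpha\log\delta_t^{-1}/(2\hat n_t^j(i))}$ (infinite when $\hat n_t^j(i)=0$). CO-UCB. At each decision round $t$, agent $j$ pulls an arm $I_t^j\in\arg\max_{i\in\mathcal{K}_j}\{\hat\mu(i,\hat n_t^j(i))+\mathrm{CI}(i,j,t)\}$,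 updates its count and empirical mean for this arm, and broadcasts the observation to all other agents whose local sets contain $I_t^j$; each agent also updates counts and empirical means with every received observation of an arm in its local set. *)

(* Defs.v *)
From HB Require Import structures.
From mathcomp Require Import all_boot all_order all_algebra.
From mathcomp Require Import all_classical all_reals all_analysis.

Set Implicit Arguments.
Unset Strict Implicit.
Unset Printing Implicit Defensive.

Import Order.TTheory GRing.Theory Num.Theory.

Local Open Scope ring_scope.

(* Agents are 'I_M, arms are 'I_K, time slots are the naturals 1, 2, ...;
   [delay j k] is the number of slots a message from j to k is in transit. *)
Record bandit (R : realType) (M K : nat) := Bandit {
  mean : 'I_K -> R ;
  local : 'I_M -> {set 'I_K} ;
  gap : 'I_M -> nat ;
  delay : 'I_M -> 'I_M -> nat ;
  mean01 : forall i, 0 <= mean i <= 1 ;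
  gap_gt0 : forall j, (0 < gap j)%N ;
  local_overlap : exists j k : 'I_M, j != k /\ local j :&: local k != finset.set0 }.

Definition mutually_independent (d : measure_display) (Omega : measurableType d)
    (R : realType) (P : probability Omega R) (d' : measure_display)
    (T : measurableType d') (I : eqType) (X : I -> {RV P >-> T}) : Prop :=
  forall (s : seq I) (B : I -> set T), uniq s -> (forall k, measurable (B k)) ->
    P [set w | forall k, k \in s -> B k (X k w)]%classic
    = (\prod_(k <- s) P (X k @^-1` B k)%classic)%E.

(* [X i n] is the reward of the n-th pull of arm i (n = 0, 1, ...). Being
   independent within each arm and between the sequences of different arms
   means that the whole doubly indexed family is mutually independent. *)
Definition bernoulli_rewards (R : realType) (M K : nat) (b : bandit R M K)
    (d : measure_display) (Omega : measurableType d) (P : probability Omega R)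
    (X : 'I_K -> nat -> {RV P >-> bool}) : Prop :=
  (forall i n, distribution P (X i n) =1 bernoulli_prob (mean b i)) /\
  mutually_independent (fun p : 'I_K * nat => X p.1 p.2).

(* One execution of a protocol. [pull j t] is meaningful only when t is a
   decision round of j; [sent t j k] says that at slot t agent j sends the
   observation it makes at slot t to agent k. *)
Record history (M K : nat) := History {
  pull : 'I_M -> nat -> 'I_K ;
  sent : nat -> 'I_M -> 'I_M -> bool }.

Section Protocol.
Variables (R : realType) (M K : nat) (b : bandit R M K) (T : nat).

Definition action_rate (j : 'I_M) : R := ((gap b j)%:R)^-1.

Definition total_rate : R := \sum_(j < M) action_rate j.

Definition num_rounds (j : 'I_M) : nat := (T %/ gap b j)%N.

Definition decision_rounds (j : 'I_M) : seq nat :=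
  [seq (l * gap b j)%N | l <- iota 1 (num_rounds j)].

Variable (h : history M K).

Definition comm_complexity : nat :=
  (\sum_(1 <= t < T.+1) #|[set p : 'I_M * 'I_M | sent h t p.1 p.2]|)%N.

(* Number of pulls of arm i, by all agents, strictly before the pull of agent j
   at slot t; simultaneous pulls are ordered by the index of the agent. *)
Definition pull_rank (i : 'I_K) (j : 'I_M) (t : nat) : nat :=
  (\sum_(k < M) count (fun s =>
     (pull h k s == i) && ((s < t) || ((s == t) && (k < j)))) (decision_rounds k))%N.

(* The realized rewards, x i n being that of the n-th pull of arm i. *)
Variable x : 'I_K -> nat -> bool.

Definition observation (j : 'I_M) (t : nat) : R :=
  (x (pull h j t) (pull_rank (pull h j t) j t))%:R.

(* The observation made by k at slot s is usable by j at slot t: j has made or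
   received it during one of the slots 1, ..., t - 1. *)
Definition available (j : 'I_M) (t : nat) (k : 'I_M) (s : nat) : bool :=
  ((k == j) && (s < t)%N) || (sent h s k j && (s + delay b k j < t)%N).

Definition obs_count (j : 'I_M) (t : nat) (i : 'I_K) : nat :=
  (\sum_(k < M) count (fun s => available j t k s && (pull h k s == i))
                      (decision_rounds k))%N.

Definition emp_mean (j : 'I_M) (t : nat) (i : 'I_K) : R :=
  (\sum_(k < M) \sum_(s <- decision_rounds k |
      available j t k s && (pull h k s == i)) observation k s)
  / (obs_count j t i)%:R.

Variables (alpha : R) (delta : nat -> R).

Definition conf_radius (j : 'I_M) (t : nat) (i : 'I_K) : \bar R :=
  if obs_count j t i == 0%N then +oo%E
  else (Num.sqrt (alpha * ln ((delta t)^-1) / (2 * (obs_count j t i)%:R)))%:E.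

Definition ucb_index (j : 'I_M) (t : nat) (i : 'I_K) : \bar R :=
  ((emp_mean j t i)%:E + conf_radius j t i)%E.

Definition co_ucb : Prop :=
  (forall j t, t \in decision_rounds j ->
     pull h j t \in local b j /\
     (forall i, i \in local b j ->
        (ucb_index j t i <= ucb_index j t (pull h j t))%E)) /\
  (forall t j k, (1 <= t <= T)%N ->
     sent h t j k =
     [&& t \in decision_rounds j, k != j & pull h j t \in local b k]).

End Protocol.

(* Main.v *)
(* A message is sent only at a decision round of its sender, to at most M
   recipients, and agent j has at most T / gap j decision rounds; hence at most
   M * (T / gap j) messages come from agent j, and the constant 1 works. *)

Require Import Defs.
From HB Require Import structures.
From mathcomp Require Import all_boot all_order all_algebra.
From mathcomp Require Import all_classical all_reals all_analysis.

Set Implicit Arguments.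
Unset Strict Implicit.
Unset Printing Implicit Defensive.

Import Order.TTheory GRing.Theory Num.Theory.

Local Open Scope ring_scope.

(** The sum is the size of [r] filtered by membership in [s], a duplicate-free list contained in
    [s]. It serves with [r] the slots up to the horizon and [s] the rounds of one agent. *)
Lemma sum_mem_le_size (r s : seq nat) :
  uniq r -> (\sum_(t <- r) (t \in s) <= size s)%N.
Proof.
move=> ur.
have -> : (\sum_(t <- r) (t \in s))%N = size [seq t <- r | t \in s].
  rewrite size_filter -sum1_count [RHS]big_mkcond /=.
  by apply: eq_bigr => t _; case: (t \in s).
apply: uniq_leq_size; first exact: filter_uniq.
by move=> t; rewrite mem_filter => /andP[].
Qed.

Lemma size_decision_rounds (R : realType) (M K : nat) (b : bandit R M K)
    (T : nat) (j : 'I_M) : size (decision_rounds b T j) = num_rounds b T j.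
Proof. by rewrite size_map size_iota. Qed.

Lemma num_rounds_le (R : realType) (M K : nat) (b : bandit R M K)
    (T : nat) (j : 'I_M) : (num_rounds b T j)%:R <= action_rate b j * T%:R.
Proof.
rewrite mulrC ler_pdivlMr ?ltr0n ?gap_gt0 //.
by rewrite -natrM ler_nat leq_divM.
Qed.

Lemma comm_complexity_le (R : realType) (M K : nat) (b : bandit R M K)
    (T : nat) (h : history M K) :
  (forall t j k, (1 <= t <= T)%N -> sent h t j k ->
     t \in decision_rounds b T j) ->
  (comm_complexity T h <= M * \sum_(j < M) num_rounds b T j)%N.
Proof.
move=> sentP.
(* Slot by slot, agent [j] sends nothing outside its decision rounds and at most [M] messages at one
   of them. *)
apply: (@leq_trans
  (\sum_(1 <= t < T.+1) \sum_(j < M) M * (t \in decision_rounds b T j))%N).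
  rewrite /comm_complexity !big_seq; apply: leq_sum => t.
  rewrite mem_index_iota ltnS => tT.
  rewrite cardsE -sum1_card big_mkcond /=.
  rewrite -(pair_bigA _ (fun j k => if sent h t j k then 1 else 0)%N) /=.
  apply: leq_sum => j _.
  (* The factor [M] is unfolded into a sum over recipients [k], so that the two sides compare term
     by term. *)
  rewrite -[X in (_ <= X * _)%N](card_ord M) -sum_nat_const.
  apply: leq_sum => k _.
  by case: ifP => // /sentP ->.
(* With the agent outermost, what remains is to count the slots that are its decision rounds. Below,
   [orbT] absorbs the case [M == 0] from [leq_mul2l]. *)
rewrite exchange_big big_distrr /=; apply: leq_sum => j _.
rewrite -big_distrr /= leq_mul2l -size_decision_rounds.
by rewrite sum_mem_le_size ?orbT ?iota_uniq.
Qed.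

Theorem theorem3 (R : realType) :
  exists2 c : R, 0 < c &
  forall (M K : nat) (b : bandit R M K)
    (d : measure_display) (Omega : measurableType d) (P : probability Omega R)
    (X : 'I_K -> nat -> {RV P >-> bool})
    (alpha : R) (delta : nat -> R) (T : nat) (h : Omega -> history M K),
  bernoulli_rewards b X ->
  2 < alpha ->
  (forall t, (1 <= t <= T)%N -> 0 < delta t <= 1) ->
  (forall w, co_ucb b T (h w) (fun i n => X i n w) alpha delta) ->
  forall w, (comm_complexity T (h w))%:R <= c * (M%:R * total_rate b * T%:R).
Proof.
exists 1 => // M K b d Omega P X alpha delta T h _ _ _ co w.
have [_ sentE] := co w.
have sentP t j k : (1 <= t <= T)%N -> sent (h w) t j k ->
    t \in decision_rounds b T j.
  by move=> tT; rewrite sentE // => /and3P[].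
rewrite mul1r -mulrA.
(* The counting is done in the naturals; the floors in [num_rounds] are dropped only after the cast
   to [R], agent by agent, once [T] is distributed over [total_rate]. *)
apply: (@le_trans _ _ (M * \sum_(j < M) num_rounds b T j)%N%:R).
  by rewrite ler_nat comm_complexity_le.
rewrite natrM ler_wpM2l // natr_sum /total_rate mulr_suml.
by apply: ler_sum => j _; exact: num_rounds_le.
Qed.
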